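(* Let $h:J\to\mathbb{R}^M$ be the fractal interpolation function described in the context, with $q_k\in\mathcal{AC}(J,\mathbb{R}^M)$ for each $k\in T$. Set $a_{\min}=\min\{|a_k|:k\in T\}$ and $\alpha_{\max}=\max\{|\alpha_k|:k\in T\}$. If $\alpha_{\max}<\dfrac{a_{\min}}{N-1}$, then $h\in\mathcal{AC}(J,\mathbb{R}^M)$. Moreover, $\dim_H(G(h))=\dim_B(G(h))=1$.
   Context: Setting: $M\ge 1$, $(x_i,\boldsymbol{y}_i)\in\mathbb{R}\times\mathbb{R}^M$ ($i=1,\dots,N$) are data points with $x_1<x_2<\dots<x_N$, $T=\{1,\dots,N-1\}$, $J=[x_1,x_N]$, $J_k=[x_k,x_{k+1}]$. For $k\in T$, $P_k(t)=a_kt+d_k$ is the affine map $J\to J_k$ with $P_k(x_1)=x_k$, $P_k(x_N)=x_{k+1}$; each $P_k$ is contractive (so $N\ge 3$). For $k\in T$, $\alpha_k\in(-1,1)$ and $q_k:J\to\mathbb{R}^M$ is continuous with $q_k(x_1)=\boldsymbol{y}_k-\alpha_k\boldsymbol{y}_1$, $q_k(x_N)=\boldsymbol{y}_{k+1}-\alpha_k\boldsymbol{y}_N$. With $W_k(t,\boldsymbol{z})=(P_k(t),\alpha_k\boldsymbol{z}+q_k(t))$, the IFS $\{J\times\mathbb{R}^M;W_1,\dots,W_{N-1}\}$ has a unique attractor, which is the graph $G(h)$ of a continuous function $h:J\to\mathbb{R}^M$, the fractal interpolation function (FIF), satisfying $h(t)=\alpha_k h(P_k^{-1}(t))+q_k(P_k^{-1}(t))$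 for $t\in J_k$, $k\in T$. $\mathcal{AC}(J,\mathbb{R}^M)$ is the space of absolutely continuous functions $J\to\mathbb{R}^M$. $\dim_H$ and $\dim_B$ denote Hausdorff and box-counting dimension. *)

(* Defs.v *)
From HB Require Import structures.
From mathcomp Require Import all_boot all_order all_algebra.
From mathcomp Require Import all_classical all_reals all_analysis.
Set Implicit Arguments.
Unset Strict Implicit.
Unset Printing Implicit Defensive.
Import Order.TTheory GRing.Theory Num.Theory.
Import numFieldNormedType.Exports.
Local Open Scope classical_set_scope.
Local Open Scope ring_scope.

(* The library's norms on 'rV[R]_M and on products are sup norms; lengths and
   diameters below are Euclidean. *)
Definition eucl_norm (R : realType) (M : nat) (v : 'rV[R]_M) : R :=
  Num.sqrt (\sum_(j < M) v 0 j ^+ 2).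

Definition eucl_dist (R : realType) (M : nat) (u v : R * 'rV[R]_M) : R :=
  Num.sqrt ((u.1 - v.1) ^+ 2 + eucl_norm (u.2 - v.2) ^+ 2).

Definition abs_continuous (R : realType) (M : nat) (a b : R)
    (f : R -> 'rV[R]_M) : Prop :=
  forall e : R, 0 < e -> exists2 r : R, 0 < r &
    forall (n : nat) (s t : 'I_n -> R),
      (forall i, [/\ a <= s i, s i < t i & t i <= b]) ->
      trivIset [set: 'I_n] (fun i => `]s i, t i[%classic) ->
      \sum_(i < n) (t i - s i) < r ->
      \sum_(i < n) eucl_norm (f (t i) - f (s i)) < e.

(* The element 0 only matters for the empty set, whose diameter is 0. *)
Definition diam (R : realType) (X : Type) (dist : X -> X -> R) (A : set X)
    : \bar R :=
  ereal_sup (0%E |` [set e | exists u v, [/\ A u, A v & e = (dist u v)%:E]]).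

(* The case distinction gives the conventions |A|^0 = 1 for nonempty A (also
   when |A| = 0) and |set0|^s = 0 for every s. *)
Definition diam_pow (R : realType) (X : Type) (dist : X -> X -> R) (s : R)
    (A : set X) : \bar R :=
  if A == set0 then 0%E else (diam dist A `^ s)%E.

(* Infimum over countable covers; finite covers are padded with set0. *)
Definition hausdorff_content (R : realType) (X : Type) (dist : X -> X -> R)
    (s r : R) (F : set X) : \bar R :=
  ereal_inf [set (\sum_(0 <= i <oo) diam_pow dist s (U i))%E
    | U in [set U : nat -> set X | F `<=` \bigcup_i U i /\
                                   forall i, (diam dist (U i) <= r%:E)%E]].

(* The supremum over r > 0 is the limit as r tends to 0, as the contents
   increase when r decreases. *)
Definition hausdorff_measure (R : realType) (X : Type) (dist : X -> X -> R)
    (s : R) (F : set X) : \bar R :=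
  ereal_sup [set hausdorff_content dist s r F | r in [set r : R | 0 < r]].

Definition hausdorff_dim (R : realType) (X : Type) (dist : X -> X -> R)
    (F : set X) : \bar R :=
  ereal_inf [set s%:E
    | s in [set s : R | 0 <= s /\ hausdorff_measure dist s F = 0%E]].

(* Least number of sets of diameter at most r covering F, +oo if there is no
   finite such cover. *)
Definition covering_number (R : realType) (X : Type) (dist : X -> X -> R)
    (r : R) (F : set X) : \bar R :=
  ereal_inf [set n%:R%:E | n in [set n : nat | exists U : 'I_n -> set X,
    F `<=` \bigcup_i U i /\ forall i, (diam dist (U i) <= r%:E)%E]].

(* The box-counting dimension of F exists, as a limit, and equals l. *)
Definition has_box_dim (R : realType) (X : Type) (dist : X -> X -> R)
    (F : set X) (l : \bar R) : Prop :=
  (lne (covering_number dist r F) * ((- ln r)^-1)%:E)%E @[r --> 0^'+] --> l.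

Definition is_attractor (X : topologicalType) (I : Type) (S : set X)
    (D : set I) (W : I -> X -> X) (A : set X) : Prop :=
  [/\ A !=set0, compact A, A `<=` S & A = \bigcup_(k in D) (W k @` A)].

Definition graph_on (S V : Type) (J : set S) (f : S -> V) : set (S * V) :=
  [set (t, f t) | t in J].

Definition fif_map (R : realType) (M : nat) (a d alpha : nat -> R)
    (q : nat -> R -> 'rV[R]_M) (k : nat) (u : R * 'rV[R]_M) : R * 'rV[R]_M :=
  (a k * u.1 + d k, alpha k *: u.2 + q k u.1).

(* Data are indexed by natural numbers, as x_1, ..., x_N and, for the maps, by
   T = {1, ..., N - 1}; values at other indices are irrelevant. *)
Record fif_data (R : realType) (M N : nat) (x : nat -> R)
    (y : nat -> 'rV[R]_M) (a d alpha : nat -> R) (q : nat -> R -> 'rV[R]_M)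
    : Prop := FifData {
  fif_dim : (1 <= M)%N;
  fif_size : (3 <= N)%N;
  fif_incr : forall k, (1 <= k < N)%N -> x k < x k.+1;
  fif_left : forall k, (1 <= k < N)%N -> a k * x 1%N + d k = x k;
  fif_right : forall k, (1 <= k < N)%N -> a k * x N + d k = x k.+1;
  fif_contr : forall k, (1 <= k < N)%N -> `|a k| < 1;
  fif_alpha : forall k, (1 <= k < N)%N -> -1 < alpha k < 1;
  fif_cont : forall k, (1 <= k < N)%N -> {within `[x 1%N, x N], continuous q k};
  fif_qleft : forall k, (1 <= k < N)%N ->
    q k (x 1%N) = y k - alpha k *: y 1%N;
  fif_qright : forall k, (1 <= k < N)%N ->
    q k (x N) = y k.+1 - alpha k *: y N }.

(* The functional equation h (P_k t) = alpha_k h(t) + q_k(t) on [x_1, x_N] is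
   the inclusion of W_k (graph h) in graph h. *)
Definition is_fif (R : realType) (M N : nat) (x : nat -> R)
    (a d alpha : nat -> R) (q : nat -> R -> 'rV[R]_M) (h : R -> 'rV[R]_M)
    : Prop :=
  {within `[x 1%N, x N], continuous h} /\
  is_attractor (`[x 1%N, x N]%classic `*` setT) [set k | (1 <= k < N)%N]
    (fif_map a d alpha q) (graph_on `[x 1%N, x N] h).

Definition min_abs (R : realType) (N : nat) (c : nat -> R) : R :=
  \big[Num.min/`|c 1%N|]_(1 <= k < N) `|c k|.

Definition max_abs (R : realType) (N : nat) (c : nat -> R) : R :=
  \big[Num.max/`|c 1%N|]_(1 <= k < N) `|c k|.

(* Main.v *)
Require Import Defs.
From HB Require Import structures.
From mathcomp Require Import all_boot all_order all_algebra.
From mathcomp Require Import all_classical all_reals all_analysis.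
From mathcomp Require Import ring lra zify.
Set Implicit Arguments.
Unset Strict Implicit.
Unset Printing Implicit Defensive.
Import Order.TTheory GRing.Theory Num.Theory.
Import numFieldNormedType.Exports.
Local Open Scope classical_set_scope.
Local Open Scope ring_scope.

(** The argument is carried out coordinate by coordinate. Absolute continuity of
    a function f is equivalent to the following affine bounds: for every e > 0
    there is L such that the total increment of f over any finite family of
    non-overlapping intervals is at most e + L l, with l the total length of
    the family. Small families give one direction at once; for the other, cut
    every interval into K equal parts, with K about l divided by the modulus of
    absolute continuity (abs_continuous_affine_bound).

    Affine bounds pass from the functions q_k to h
    (self_affine_variation_bound). Cut a family at the nodes x_k and pull the
    part in J_k back by P_k: by the functional equation its total increment is
    at most |alpha_k| times that of h over the pulled-back family, whose length
    is multiplied by 1 / a_k, plus that of q_k. The hypothesis on alpha_max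
    gives sum_k |alpha_k| < a_min < 1 and 2 |alpha_k| <= a_k, so that both the
    constant and the slope of the bound are reproduced with a contraction
    factor. The number of intervals in each pulled-back family does not exceed
    the original one, so for a fixed number of intervals the boundedness of h
    makes the relevant supremum finite, and the contraction makes its bound
    independent of that number. Hence h is absolutely continuous.

    For the dimensions, the coordinates of h have bounded variation. The
    abscissa plus the total variations of the coordinates is then a monotone
    function that dominates distances on the graph, and its level sets cut the
    graph into O(1 / r) pieces of diameter at most r (graph_linear_covers).
    Conversely the projections of any cover of the graph cover J, so by
    subadditivity of the Lebesgue measure the diameters add up to at least
    x_N - x_1 (graph_length_at_least). These two facts force both dimensions to
    be 1 (hausdorff_dim_eq1, has_box_dim_eq1). *)

(** * Euclidean norms and distances *)

Section EuclideanNorm.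
Context {R : realType}.

Lemma eucl_norm_ge_coord (M : nat) (v : 'rV[R]_M) j : `|v 0 j| <= eucl_norm v.
Proof.
rewrite /eucl_norm -[`|_|]ger0_norm ?normr_ge0// -sqrtr_sqr ler_sqrt; last first.
  by apply: sumr_ge0 => i _; exact: sqr_ge0.
rewrite real_normK ?num_real// (bigD1 j)//= lerDl.
by apply: sumr_ge0 => i _; exact: sqr_ge0.
Qed.

Lemma sqrt_sqrD_le (x y : R) : 0 <= x -> 0 <= y ->
  Num.sqrt (x ^+ 2 + y ^+ 2) <= x + y.
Proof.
move=> x0 y0; rewrite -[leRHS]ger0_norm ?addr_ge0// -sqrtr_sqr.
rewrite ler_sqrt ?sqr_ge0//.
by rewrite sqrrD lerD2r lerDl mulrn_wge0// mulr_ge0.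
Qed.

Lemma eucl_norm_le_sum (M : nat) (v : 'rV[R]_M) :
  eucl_norm v <= \sum_(j < M) `|v 0 j|.
Proof.
rewrite /eucl_norm; pose w (j : 'I_M) := `|v 0 j|.
rewrite -[leRHS]/(\sum_(j < M) w j).
have -> : \sum_(j < M) v 0 j ^+ 2 = \sum_(j < M) w j ^+ 2.
  by apply: eq_bigr => j _; rewrite /w real_normK ?num_real.
have w0 j : 0 <= w j by exact: normr_ge0.
suff: 0 <= \sum_(j < M) w j /\
    \sum_(j < M) w j ^+ 2 <= (\sum_(j < M) w j) ^+ 2.
  move=> [s0 sle]; rewrite -[leRHS]ger0_norm// -sqrtr_sqr ler_sqrt//.
  exact: sqr_ge0.
elim/big_ind2 : _ => [|x1 x2 y1 y2 [x0 xle] [y0 yle]|j _].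
- by rewrite expr0n.
- split; first exact: addr_ge0.
  rewrite sqrrD; have : 0 <= x2 * y2 by exact: mulr_ge0.
  by lra.
- by [].
Qed.

Lemma eucl_dist_ge_fst (M : nat) (u v : R * 'rV[R]_M) :
  `|u.1 - v.1| <= eucl_dist u v.
Proof.
rewrite /eucl_dist -sqrtr_sqr ler_sqrt ?lerDl ?sqr_ge0//.
by rewrite addr_ge0 ?sqr_ge0.
Qed.

Lemma eucl_dist_ge0 (M : nat) (u v : R * 'rV[R]_M) : 0 <= eucl_dist u v.
Proof. exact: sqrtr_ge0. Qed.

Lemma eucl_dist_le_sum (M : nat) (u v : R * 'rV[R]_M) :
  eucl_dist u v <= `|u.1 - v.1| + \sum_(j < M) `|u.2 0 j - v.2 0 j|.
Proof.
rewrite /eucl_dist -[(u.1 - v.1) ^+ 2]real_normK ?num_real//.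
apply: le_trans (sqrt_sqrD_le (normr_ge0 _) (sqrtr_ge0 _)) _.
rewrite lerD2l; apply: le_trans (eucl_norm_le_sum _) _.
by apply: ler_sum => j _; rewrite !mxE.
Qed.

End EuclideanNorm.

(** * Affine bounds for the variation over families of intervals *)

Section Families.
Context {R : realType}.
Implicit Types (a b : R) (f g : R -> R).

(** A finite family of non-overlapping subintervals [s i, t i] of [a, b].
    Degenerate intervals are allowed, so that families are stable under
    intersection with a subinterval. *)
Definition nonoverlapping a b n (s t : 'I_n -> R) : Prop :=
  (forall i, [/\ a <= s i, s i <= t i & t i <= b]) /\
  (forall i j z, s i < z < t i -> s j < z < t j -> i = j).

(** The total increment of f over a family of intervals is at most e plus L
    times the total length of the family. *)
Definition affine_variation_bound a b f (e L : R) : Prop :=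
  forall n (s t : 'I_n -> R), nonoverlapping a b s t ->
  \sum_(i < n) `|f (t i) - f (s i)| <= e + L * \sum_(i < n) (t i - s i).

Lemma sum_increments_ge0 n (s t : 'I_n -> R) a b :
  nonoverlapping a b s t -> 0 <= \sum_(i < n) (t i - s i).
Proof.
by move=> [st _]; apply: sumr_ge0 => i _; rewrite subr_ge0; case: (st i).
Qed.

Lemma abs_continuous_coord (M : nat) a b (f : R -> 'rV[R]_M) (j : 'I_M) :
  abs_continuous a b f -> forall e : R, 0 < e -> exists2 r : R, 0 < r &
    forall n (s t : 'I_n -> R), nonoverlapping a b s t ->
    \sum_(i < n) (t i - s i) < r ->
    \sum_(i < n) `|f (t i) 0 j - f (s i) 0 j| < e.
Proof.
move=> acf e e0; have [r r0 Hr] := acf e e0; exists r => // n s t [st triv] lr.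
(* Only the nondegenerate intervals contribute to either sum. *)
pose P := [pred i : 'I_n | s i < t i].
have degen i : ~~ P i -> t i = s i.
  rewrite /= -leNgt => ti; apply/eqP; rewrite eq_le ti.
  by case: (st i).
have sumP (F : 'I_n -> R) : (forall i, t i = s i -> F i = 0) ->
    \sum_(i < n) F i = \sum_(k < #|P|) F (enum_val k).
  move=> F0; rewrite -(big_enum_val (A := P) F)/= [LHS](bigID P)/=.
  by rewrite [X in _ + X]big1 ?addr0// => i /degen /F0.
have {}Hr := Hr #|P| (s \o enum_val) (t \o enum_val).
rewrite sumP; last by move=> i ->; rewrite subrr normr0.
apply: le_lt_trans (Hr _ _ _).
- apply: ler_sum => i _ /=; apply: le_trans (eucl_norm_ge_coord _ j).
  by rewrite !mxE.
- move=> i /=; have [? ? ?] := st (enum_val i); split => //.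
  exact: (enum_valP i).
- move=> i k _ _ [z [/=]]; rewrite !in_itv/= => zi zk.
  exact/enum_val_inj/(triv _ _ z).
- by rewrite -(sumP (fun i => t i - s i)) // => i ->; rewrite subrr.
Qed.

(** Cutting each interval of a family into K equal parts yields K families
    whose total lengths are 1/K of the original one; with K of the order of
    the total length over r, absolute continuity applies to each of them. *)
Lemma abs_continuous_affine_bound (M : nat) a b (f : R -> 'rV[R]_M)
    (j : 'I_M) : abs_continuous a b f -> forall e : R, 0 < e ->
  exists2 L : R, 0 <= L & affine_variation_bound a b (fun t => f t 0 j) e L.
Proof.
move=> acf e e0; have [r r0 Hr] := abs_continuous_coord j acf e0.
exists (e / r); first by rewrite divr_ge0// ltW.
move=> n s t stP; set l := \sum_(i < n) (t i - s i).
have l0 : 0 <= l := sum_increments_ge0 stP.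
have [st triv] := stP.
pose K := (Num.truncn (l / r)).+1.
have K0 : 0 < K%:R :> R by rewrite ltr0n.
have lK : l / K%:R < r.
  by rewrite ltr_pdivrMr// mulrC -ltr_pdivrMr// /K truncnS_gt.
have Kle : K%:R <= 1 + l / r.
  by rewrite /K -natr1 addrC lerD2l truncn_le// divr_ge0// ltW.
pose c (m : nat) i := s i + m%:R / K%:R * (t i - s i).
have cS m i : c m.+1 i - c m i = (t i - s i) / K%:R.
  by rewrite /c -natr1; field; rewrite gt_eqF.
have cge m i : s i <= c m i.
  rewrite lerDl mulr_ge0 ?divr_ge0// subr_ge0.
  by case: (st i).
have cle m i : (m <= K)%N -> c m i <= t i.
  move=> mK; have si : s i <= t i by case: (st i).
  rewrite /c -lerBrDl -[leRHS]mul1r ler_wpM2r ?subr_ge0//.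
  by rewrite ler_pdivrMr// mul1r ler_nat.
have part m : (m < K)%N ->
    \sum_(i < n) `|f (c m.+1 i) 0 j - f (c m i) 0 j| <= e.
  move=> mK; apply/ltW/Hr.
    split=> [i|i k z /andP[z1 z2] /andP[z3 z4]].
      have [? ? ?] := st i; split.
      - exact: le_trans (cge _ _).
      - by rewrite -subr_ge0 cS divr_ge0 ?subr_ge0// ltW.
      - by apply: le_trans (cle _ _ mK) _.
    apply: (triv _ _ z).
      by rewrite (le_lt_trans (cge m i)) ?(lt_le_trans z2 (cle _ _ mK)).
    by rewrite (le_lt_trans (cge m k)) ?(lt_le_trans z4 (cle _ _ mK)).
  by under eq_bigr do rewrite cS; rewrite -mulr_suml.
apply: (@le_trans _ _ (\sum_(i < n) \sum_(0 <= m < K)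
    `|f (c m.+1 i) 0 j - f (c m i) 0 j|)).
  apply: ler_sum => i _.
  have -> : f (t i) 0 j - f (s i) 0 j =
      \sum_(0 <= m < K) (f (c m.+1 i) 0 j - f (c m i) 0 j).
    rewrite (telescope_sumr (fun m => f (c m i) 0 j))//.
    have -> : c K i = t i by rewrite /c divff ?gt_eqF// mul1r addrC subrK.
    by rewrite /c !mul0r addr0.
  exact: ler_norm_sum.
rewrite exchange_big/= big_nat.
apply: (@le_trans _ _ (\sum_(0 <= m < K) e)).
  by rewrite [leRHS]big_nat; apply: ler_sum => m /andP[_ mK]; exact: part.
rewrite sumr_const_nat subn0 -mulr_natl.
have -> : e + e / r * l = (1 + l / r) * e by field; rewrite gt_eqF.
by rewrite ler_wpM2r// ltW.
Qed.

(** The converse: with e halved and shared among the M coordinates, the slopes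
    only matter through families of small total length. *)
Lemma affine_bound_abs_continuous (M : nat) a b (f : R -> 'rV[R]_M) :
  (forall j (e : R), 0 < e -> exists2 L : R, 0 <= L &
     affine_variation_bound a b (fun t => f t 0 j) e L) ->
  abs_continuous a b f.
Proof.
move=> fL e e0; pose e' := e / (2 * (M%:R + 1)).
have M0 : 0 < M%:R + 1 :> R by rewrite natr1 ltr0n.
have e'0 : 0 < e' by rewrite divr_gt0// mulr_gt0.
have /choice[L HL] : forall j, exists L : R, 0 <= L /\
    affine_variation_bound a b (fun t => f t 0 j) e' L.
  by move=> j; have [L] := fL j e' e'0; exists L.
pose S := \sum_(j < M) L j.
have S0 : 0 <= S by apply: sumr_ge0 => j _; have [] := HL j.
exists (e / 2 / (S + 1)); first by rewrite !divr_gt0//; lra.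
move=> n s t st triv lr.
have stP : nonoverlapping a b s t.
  split=> [i|i k z zi zk].
    by have [? /ltW ? ?] := st i.
  by apply: triv => //; exists z; split; rewrite /= in_itv.
have l0 := sum_increments_ge0 stP; set l := \sum_(i < n) (t i - s i) in l0 lr *.
apply: (@le_lt_trans _ _
    (\sum_(j < M) \sum_(i < n) `|f (t i) 0 j - f (s i) 0 j|)).
  rewrite exchange_big/=; apply: ler_sum => i _.
  by apply: le_trans (eucl_norm_le_sum _) _; apply: ler_sum => j _; rewrite !mxE.
apply: (@le_lt_trans _ _ (\sum_(j < M) (e' + L j * l))).
  by apply: ler_sum => j _; have [_] := HL j; apply.
rewrite big_split/= sumr_const card_ord -mulr_suml -/S -mulr_natl.
have : M%:R * e' <= e / 2.
  have -> : e / 2 = (M%:R + 1) * e' by rewrite /e'; field; rewrite gt_eqF.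
  by rewrite ler_wpM2r ?ltW// ltrDl.
have : S * l < e / 2.
  have := lr; rewrite ltr_pdivlMr; last by lra.
  by move: l0; nra.
by lra.
Qed.

End Families.

(** * The variation of self-affine functions *)

Section SelfAffine.
Context {R : realType}.
Implicit Types (f g : R -> R).

(** The point of [u, v] nearest to t. *)
Definition clamp (u v t : R) : R := Num.max u (Num.min t v).

Lemma clamp_in u v t : u <= v -> u <= clamp u v t <= v.
Proof. by move=> uv; rewrite /clamp le_max lexx ge_max uv ge_min lexx orbT. Qed.

Lemma clamp_le u v s t : s <= t -> clamp u v s <= clamp u v t.
Proof.
move=> st; rewrite /clamp ge_max !le_max lexx/= le_min !ge_min st lexx orbT.
by rewrite orbT.
Qed.

(** A point strictly between clamped endpoints lies between the endpoints. *)
Lemma clamp_between u v s t z :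
  clamp u v s < z < clamp u v t -> s < z < t.
Proof.
rewrite /clamp gt_max lt_max gt_min lt_min => /andP[/andP[uz szv] zuv].
move: zuv; rewrite ltNge (ltW uz)/= => /andP[zt zv].
by move: szv; rewrite [v < z]ltNge (ltW zv) orbF => ->.
Qed.

(** Telescoping over the subdivision x 1 <= ... <= x m: the increment of f up
    to t is the sum of the increments over the parts of the pieces below t. *)
Lemma sum_clamp (x : nat -> R) m f t :
  (0 < m)%N -> (forall k, (1 <= k < m)%N -> x k <= x k.+1) -> x 1%N <= t ->
  \sum_(1 <= k < m) (f (clamp (x k) (x k.+1) t) - f (x k)) =
  f (Num.min t (x m)) - f (x 1%N).
Proof.
move=> m0 + x1t; elim: m m0 => // -[|m] IH _ xle.
  by rewrite big_geq// min_r// subrr.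
rewrite big_nat_recr//= IH//; last first.
  by move=> k /andP[k1 km]; rewrite xle// k1 ltnW.
have xm : x m.+1 <= x m.+2 by rewrite xle//= ltnSn.
rewrite /clamp; have [txm|/ltW xmt] := leP t (x m.+1).
  by rewrite (@min_l _ _ t)// ?(le_trans txm)// max_l// subrr addr0.
by rewrite max_r ?le_min ?xmt// addrC subrKA.
Qed.

(** The preimage of a family under the affine map t |-> a t + d, which maps
    [p, p'] onto [u, v], after intersection with [u, v]. *)
Lemma nonoverlapping_pullback (p p' u v a d : R) n (s t : 'I_n -> R) A B :
  0 < a -> a * p + d = u -> a * p' + d = v -> u <= v ->
  nonoverlapping A B s t ->
  nonoverlapping p p' (fun i => (clamp u v (s i) - d) / a)
                      (fun i => (clamp u v (t i) - d) / a).
Proof.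
move=> a0 pu p'v uv [st triv]; split => [i|i j z zi zj].
  have [_ sti _] := st i.
  have /andP[us _] := clamp_in (s i) uv; have /andP[_ tv] := clamp_in (t i) uv.
  split.
  - by rewrite ler_pdivlMr// lerBrDr mulrC pu.
  - by rewrite ler_pM2r ?invr_gt0// lerD2r clamp_le.
  - by rewrite ler_pdivrMr// lerBlDr mulrC p'v.
have mem (w w' : R) : (w - d) / a < z < (w' - d) / a -> w < a * z + d < w'.
  by rewrite ltr_pdivrMr// ltr_pdivlMr// ltrBlDr ltrBrDr mulrC.
apply: (triv i j (a * z + d)).
  exact: clamp_between (mem _ _ zi).
exact: clamp_between (mem _ _ zj).
Qed.

(** Let f satisfy f (P_k t) = alpha_k f(t) + g_k(t), where the affine maps P_k
    carry [x_1, x_N] onto the pieces [x_k, x_(k+1)]. For a fixed number n of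
    intervals, the supremum S of the excess (total increment of f minus L times
    total length) is finite since f is bounded. Cutting a family at the points
    x_k and pulling the pieces back by P_k gives S <= sigma S + c with
    sigma the sum of the |alpha_k|, hence the bound c / (1 - sigma) for S,
    which does not depend on n. *)
Lemma self_affine_variation_bound N (x a d alpha : nat -> R) f
    (g : nat -> R -> R) (B : R) :
  (0 < N)%N ->
  (forall k, (1 <= k < N)%N -> x k < x k.+1) ->
  (forall k, (1 <= k < N)%N -> 0 < a k) ->
  (forall k, (1 <= k < N)%N -> a k * x 1%N + d k = x k) ->
  (forall k, (1 <= k < N)%N -> a k * x N + d k = x k.+1) ->
  x 1%N <= x N ->
  (forall k, (1 <= k < N)%N -> forall t, x 1%N <= t <= x N ->
    f (a k * t + d k) = alpha k * f t + g k t) ->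
  (forall t, x 1%N <= t <= x N -> `|f t| <= B) ->
  (forall k, (1 <= k < N)%N -> 2 * `|alpha k| <= a k) ->
  \sum_(1 <= k < N) `|alpha k| < 1 ->
  (forall k, (1 <= k < N)%N -> forall e : R, 0 < e -> exists2 L : R, 0 <= L &
    affine_variation_bound (x 1%N) (x N) (g k) e L) ->
  forall e : R, 0 < e -> exists2 L : R, 0 <= L &
    affine_variation_bound (x 1%N) (x N) f e L.
Proof.
move=> N0 xlt a0 Pl Pr x1N feq fB al2 als gL e e0.
set sigma := \sum_(1 <= k < N) _ in als.
pose e' := e * (1 - sigma) / N%:R.
have NR0 : 0 < N%:R :> R by rewrite ltr0n.
have e'0 : 0 < e' by rewrite !mulr_gt0 ?invr_gt0// subr_gt0.
have /choice[L HL] : forall k, exists L : R, 0 <= L /\ ((1 <= k < N)%N ->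
    affine_variation_bound (x 1%N) (x N) (g k) e' L).
  move=> k; have [kN|_] := boolP (1 <= k < N)%N; last by exists 0.
  by have [L] := gL k kN e' e'0; exists L.
(* As 2 |alpha_k| <= a_k, a slope L with 2 L_k / a_k <= L for all k satisfies
   (|alpha_k| L + L_k) / a_k <= L, so that it is reproduced by the maps. *)
pose Lam := 2 * \sum_(1 <= k < N) L k / a k.
have La0 k : (1 <= k < N)%N -> 0 <= L k / a k.
  by move=> kN; rewrite divr_ge0//; [case: (HL k)|rewrite ltW// a0].
have Lam_ge k : (1 <= k < N)%N -> 2 * (L k / a k) <= Lam.
  move=> kN; rewrite ler_wpM2l//.
  rewrite (bigD1_seq k)/= ?iota_uniq ?mem_index_iota// lerDl big_seq_cond.
  by apply: sumr_ge0 => i; rewrite mem_index_iota => /andP[iN _]; exact: La0.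
have Lam0 : 0 <= Lam.
  by rewrite mulr_ge0// big_nat sumr_ge0// => k kN; exact: La0.
exists Lam => // n.
pose exc (s t : 'I_n -> R) :=
  \sum_(i < n) `|f (t i) - f (s i)| - Lam * \sum_(i < n) (t i - s i).
pose E := [set v : R | exists s t : 'I_n -> R,
  nonoverlapping (x 1%N) (x N) s t /\ v = exc s t].
have E0 : E !=set0.
  exists (exc (fun=> x 1%N) (fun=> x 1%N)); exists (fun=> x 1%N), (fun=> x 1%N).
  split=> //; split => // i j z /andP[z1 z2].
  by have := lt_trans z1 z2; rewrite ltxx.
have EB : has_ubound E.
  exists (\sum_(i < n) (B + B)) => _ [s [t [stP ->]]].
  rewrite lerBlDr -[leLHS]addr0; apply: lerD; last first.
    by rewrite mulr_ge0// (sum_increments_ge0 stP).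
  apply: ler_sum => i _; have [sti _] := stP; have [s1 s2 s3] := sti i.
  apply: le_trans (ler_normB _ _) _.
  by rewrite lerD// fB// ?(le_trans s1)//= (le_trans s2).
set S := sup E.
have excS : forall s t, nonoverlapping (x 1%N) (x N) s t -> exc s t <= S.
  by move=> s t stP; apply: ub_le_sup => //; exists s, t.
have step : forall s t, nonoverlapping (x 1%N) (x N) s t ->
    exc s t <= sigma * S + N%:R * e'.
  move=> s t stP; have [sti _] := stP.
  pose c k := clamp (x k) (x k.+1).
  pose l k := \sum_(i < n) (c k (t i) - c k (s i)).
  have xle k : (1 <= k < N)%N -> x k <= x k.+1 by move=> /xlt/ltW.
  have cut (h : R -> R) i :
      h (t i) - h (s i) = \sum_(1 <= k < N) (h (c k (t i)) - h (c k (s i))).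
    have [s1 s2 s3] := sti i; have s4 := le_trans s1 s2.
    have s5 := le_trans s2 s3.
    have := sum_clamp h N0 xle s4; have := sum_clamp h N0 xle s1.
    rewrite !min_l// => h1 h2.
    transitivity ((h (t i) - h (x 1%N)) - (h (s i) - h (x 1%N))); first by ring.
    rewrite -h1 -h2 -sumrB; apply: eq_bigr => k _.
    by rewrite /c; ring.
  have lE : \sum_(i < n) (t i - s i) = \sum_(1 <= k < N) l k.
    by rewrite exchange_big/=; apply: eq_bigr => i _; rewrite (cut id i).
  have l0 k : 0 <= l k.
    apply: sumr_ge0 => i _; rewrite subr_ge0 clamp_le//.
    by case: (sti i).
  have piece k : (1 <= k < N)%N ->
      \sum_(i < n) `|f (c k (t i)) - f (c k (s i))| <=
      `|alpha k| * S + e' + Lam * l k.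
    move=> kN; have ak0 := a0 k kN.
    pose u w := (c k w - d k) / a k.
    have stk : nonoverlapping (x 1%N) (x N) (u \o s) (u \o t).
      apply: nonoverlapping_pullback stP => //.
      - exact: Pl.
      - exact: Pr.
      - exact: xle.
    have [stk1 _] := stk.
    have cu w : c k w = a k * u w + d k.
      by rewrite /u mulrCA divff ?gt_eqF// mulr1 subrK.
    have lu : \sum_(i < n) (u (t i) - u (s i)) = l k / a k.
      rewrite /l mulr_suml; apply: eq_bigr => i _.
      by rewrite /u -mulrBl; congr (_ * _); ring.
    apply: (@le_trans _ _ (\sum_(i < n) (`|alpha k| * `|f (u (t i)) - f (u (s i))|
        + `|g k (u (t i)) - g k (u (s i))|))).
      apply: ler_sum => i _; have [s1 s2 s3] := stk1 i.
      rewrite !cu !feq//; [|by rewrite s1 (le_trans s2)|by rewrite s3 (le_trans s1)].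
      rewrite -normrM.
      set F := f (u (t i)); set F' := f (u (s i)).
      set G := g k _; set G' := g k _.
      have -> : alpha k * F + G - (alpha k * F' + G') = alpha k * (F - F') + (G - G').
        by ring.
      exact: ler_normD.
    rewrite big_split/= -mulr_sumr.
    have := excS _ _ stk; rewrite /exc /= lu lerBlDr => fk.
    have [Lk0 /(_ kN)/(_ _ _ _ stk)/=] := HL k; rewrite lu => gk.
    apply: le_trans (lerD (ler_wpM2l (normr_ge0 _) fk) gk) _.
    rewrite mulrDr -!addrA lerD2l [leLHS]addrCA lerD2l.
    have half : `|alpha k| / a k <= 2^-1.
      by rewrite ler_pdivrMr// -ler_pdivrMl// invrK al2.
    have -> : `|alpha k| * (Lam * (l k / a k)) + L k * (l k / a k) =
      (Lam * (`|alpha k| / a k) + L k / a k) * l k by field; rewrite gt_eqF.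
    apply: ler_wpM2r => //.
    have := ler_wpM2l Lam0 half; have := Lam_ge k kN.
    by lra.
  rewrite /exc lE.
  rewrite lerBlDr.
  apply: (@le_trans _ _
      (\sum_(1 <= k < N) \sum_(i < n) `|f (c k (t i)) - f (c k (s i))|)).
    rewrite exchange_big/=; apply: ler_sum => i _; rewrite (cut f i).
    exact: ler_norm_sum.
  apply: (@le_trans _ _
      (\sum_(1 <= k < N) (`|alpha k| * S + e' + Lam * l k))).
    by rewrite big_nat [leRHS]big_nat; apply: ler_sum => k; exact: piece.
  rewrite !big_split/= sumr_const_nat -mulr_suml -mulr_sumr lerD2r lerD2l.
  by rewrite -[leLHS]mulr_natl ler_wpM2r ?(ltW e'0)// ler_nat leq_subr.
have SS : S <= sigma * S + N%:R * e'.
  by apply: ge_sup => // _ [s [t [stP ->]]]; exact: step.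
have Se : S <= e.
  have : (1 - sigma) * S <= (1 - sigma) * e.
    have -> : (1 - sigma) * e = N%:R * e' by rewrite /e'; field; rewrite gt_eqF.
    by lra.
  by rewrite ler_pM2l// subr_gt0.
by move=> s t /excS; rewrite /exc lerBlDr => /le_trans; apply; rewrite lerD2r.
Qed.

End SelfAffine.

(** * Dimension one from coverings and lengths *)

Section DimensionOne.
Context {R : realType} {X : Type} (dist : X -> X -> R).
Implicit Types (A F : set X) (U : nat -> set X).

Lemma diam_ge0 A : (0 <= diam dist A)%E.
Proof. by apply: ereal_sup_ubound; left. Qed.

Lemma diam_set0 : diam dist set0 = 0%E.
Proof.
apply/eqP; rewrite eq_le diam_ge0 andbT; apply: ge_ereal_sup => z [->//|].
by move=> [u [v []]].
Qed.

Lemma diam_le (r : R) A : 0 <= r -> (forall u v, A u -> A v -> dist u v <= r) ->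
  (diam dist A <= r%:E)%E.
Proof.
move=> r0 Ar; apply: ge_ereal_sup => z [->|[u [v [Au Av ->]]]].
  by rewrite lee_fin.
by rewrite lee_fin Ar.
Qed.

Lemma dist_le_diam A u v : A u -> A v -> ((dist u v)%:E <= diam dist A)%E.
Proof. by move=> Au Av; apply: ereal_sup_ubound; right; exists u, v. Qed.

Lemma diam_pow_ge0 (s : R) A : (0 <= diam_pow dist s A)%E.
Proof. by rewrite /diam_pow; case: ifP => // _; exact: poweR_ge0. Qed.

Lemma diam_pow_le (s r : R) A : 0 <= s -> (diam dist A <= r%:E)%E ->
  (diam_pow dist s A <= (r `^ s)%:E)%E.
Proof.
move=> s0 Ar; rewrite /diam_pow; case: ifP => [_|_].
  by rewrite lee_fin powR_ge0.
rewrite -poweR_EFin; apply: gt0_ler_poweR => //.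
- by rewrite in_itv/= diam_ge0 leey.
- by rewrite in_itv/= leey (le_trans (diam_ge0 A) Ar).
Qed.

Lemma diam_le_pow (s : R) A : s <= 1 -> (diam dist A <= 1)%E ->
  (diam dist A <= diam_pow dist s A)%E.
Proof.
move=> s1; rewrite /diam_pow; case: eqP => [->|_]; first by rewrite diam_set0.
have := diam_ge0 A; case: (diam dist A) => [D| |]//.
rewrite poweR_EFin !lee_fin le_eqVlt => /predU1P[<- _|D0 D1].
  exact: powR_ge0.
by rewrite -[leLHS]powRr1 ?(ltW D0)// ger_powR// D0.
Qed.

(** A finite cover continued by empty sets. *)
Definition pad n (U : 'I_n -> set X) (i : nat) : set X :=
  if insub i is Some k then U k else set0.

Lemma padE n (U : 'I_n -> set X) (i : 'I_n) : pad U i = U i.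
Proof. by rewrite /pad insubT//= => h; congr U; exact: val_inj. Qed.

Lemma pad0 n (U : 'I_n -> set X) i : (n <= i)%N -> pad U i = set0.
Proof. by move=> ni; rewrite /pad insubF// ltnNge ni. Qed.

Lemma pad_cover n (U : 'I_n -> set X) F :
  F `<=` \bigcup_i U i -> F `<=` \bigcup_i pad U i.
Proof. by move=> FU u /FU[i _ Ui]; exists i => //; rewrite padE. Qed.

Lemma pad_diam n (U : 'I_n -> set X) (r : R) i : 0 <= r ->
  (forall i, (diam dist (U i) <= r%:E)%E) -> (diam dist (pad U i) <= r%:E)%E.
Proof.
move=> r0 Ur; have [ni|ni] := leqP n i; last by rewrite (padE U (Ordinal ni)).
by rewrite pad0// diam_set0 lee_fin.
Qed.

Lemma pad_sum n (U : 'I_n -> set X) (f : set X -> \bar R) (v : R) :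
  f set0 = 0%E -> (forall A, 0 <= f A)%E -> (forall i, f (U i) <= v%:E)%E ->
  (\sum_(0 <= i <oo) f (pad U i) <= (n%:R * v)%:E)%E.
Proof.
move=> f0 fge0 fU; rewrite (nneseries_split _ n)// add0n.
rewrite [X in (_ + X)%E]eseries0 ?adde0; last by move=> i ni _; rewrite pad0.
rewrite big_mkord; apply: (@le_trans _ _ (\sum_(i < n) v%:E)%E).
  by apply: lee_sum => i _; rewrite padE.
by rewrite sumEFin sumr_const card_ord mulr_natl.
Qed.

Variables (F : set X) (C l : R).

(** At every scale r <= 1, at most C / r sets of diameter at most r suffice to
    cover F. *)
Definition linear_covers : Prop := forall r : R, 0 < r <= 1 ->
  exists n (U : 'I_n -> set X), [/\ n%:R * r <= C, F `<=` \bigcup_i U i &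
    forall i, (diam dist (U i) <= r%:E)%E].

(** The diameters of a countable cover of F by sets of bounded diameter add up
    to at least l. *)
Definition length_at_least : Prop := forall U (r : R), F `<=` \bigcup_i U i ->
  (forall i, (diam dist (U i) <= r%:E)%E) ->
  (l%:E <= \sum_(0 <= i <oo) diam dist (U i))%E.

Hypotheses (l0 : 0 < l) (FC : linear_covers) (Fl : length_at_least).

Lemma linear_covers_gt0 : 0 < C.
Proof.
have [|n [U [nC FU Ud]]] := FC (r := 1); first by rewrite ltr01 lexx.
apply: lt_le_trans nC; rewrite mulr1 (lt_le_trans l0)//.
have := Fl (pad_cover FU) (fun i => pad_diam i ler01 Ud).
move=> /le_trans/(_ (pad_sum diam_set0 diam_ge0 Ud)).
by rewrite lee_fin mulr1.
Qed.

(** Sets of diameter at most 1 satisfy |A| <= |A|^s for s <= 1, so the sums of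
    the powers over a cover are at least l. *)
Lemma hausdorff_measure_gt0 (s : R) : s <= 1 ->
  (0 < hausdorff_measure dist s F)%E.
Proof.
move=> s1; apply: (@lt_le_trans _ _ l%:E); first by rewrite lte_fin.
apply: le_trans (ereal_sup_ubound _); last by exists 1 => //=.
apply: le_ereal_inf_tmp => _ [U [FU Ud] <-].
apply: le_trans (Fl FU Ud) _.
apply: lee_nneseries => i *; first exact: diam_ge0.
exact: diam_le_pow.
Qed.

Lemma hausdorff_measure_eq0 (s : R) : 1 < s -> hausdorff_measure dist s F = 0%E.
Proof.
move=> s1; have C0 := linear_covers_gt0; have s0 : 0 < s by lra.
apply/eqP; rewrite eq_le; apply/andP; split; last first.
  apply: le_trans (ereal_sup_ubound _); last by exists 1 => //=.
  apply: le_ereal_inf_tmp => _ [U _ <-].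
  by apply: nneseries_ge0 => i _ _; exact: diam_pow_ge0.
apply: ge_ereal_sup => _ [r/= r0 <-].
apply/lee_addgt0Pr => e e0; rewrite add0e.
(* A scale rho <= r at which the estimate C rho^(s - 1) is below e. *)
pose w := (e / C) `^ (s - 1)^-1.
pose rho := Num.min 1 (Num.min r w).
have w0 : 0 < w by rewrite powR_gt0// divr_gt0.
have rho0 : 0 < rho by rewrite !lt_min ltr01 r0 w0.
have rho1 : rho <= 1 by rewrite ge_min lexx.
have rhor : rho <= r by rewrite !ge_min lexx orbT.
have rhow : rho <= w by rewrite !ge_min lexx !orbT.
have [|n [U [nC FU Ud]]] := FC (r := rho); first by rewrite rho0.
apply: (@le_trans _ _ (\sum_(0 <= i <oo) diam_pow dist s (pad U i))%E).
  apply: ereal_inf_lbound; exists (pad U) => //; split; first exact: pad_cover.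
  by move=> i; rewrite (le_trans (pad_diam i (ltW rho0) Ud))// lee_fin.
have Us i : (diam_pow dist s (U i) <= (rho `^ s)%:E)%E.
  by apply: diam_pow_le; [exact: ltW|exact: Ud].
apply: (le_trans (pad_sum _ (diam_pow_ge0 s) Us)).
  by rewrite /diam_pow eqxx.
rewrite lee_fin.
have -> : rho `^ s = rho * rho `^ (s - 1).
  rewrite -{2}[rho]powRr1 ?(ltW rho0)// -powRD; first by congr powR; ring.
  by apply/implyP => _; rewrite gt_eqF.
rewrite mulrA; apply: (@le_trans _ _ (C * (e / C))); last first.
  by rewrite mulrCA divff ?gt_eqF// mulr1.
apply: ler_pM => //; first by rewrite mulr_ge0// ltW.
  exact: powR_ge0.
have -> : e / C = w `^ (s - 1).
  by rewrite /w -powRrM mulVf ?powRr1 ?divr_ge0 ?ltW// gt_eqF// subr_gt0.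
by apply: ge0_ler_powR => //; rewrite ?nnegrE ?subr_ge0 ltW.
Qed.

Lemma hausdorff_dim_eq1 : hausdorff_dim dist F = 1%E.
Proof.
apply/eqP; rewrite eq_le; apply/andP; split.
  apply/lee_addgt0Pr => e e0; apply: ereal_inf_lbound.
  exists (1 + e) => //=; split; first by rewrite addr_ge0// ltW.
  by apply: hausdorff_measure_eq0; rewrite ltrDl.
apply: le_ereal_inf_tmp => _ [s [s0 Hs] <-]; rewrite lee_fin.
rewrite leNgt; apply/negP => s1.
by have := hausdorff_measure_gt0 (ltW s1); rewrite Hs ltxx.
Qed.

Lemma covering_number_le (r : R) : 0 < r <= 1 ->
  (covering_number dist r F <= (C / r)%:E)%E.
Proof.
move=> r01; have [n [U [nC FU Ud]]] := FC r01; have /andP[r0 _] := r01.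
apply: (@le_trans _ _ n%:R%:E).
  by apply: ereal_inf_lbound; exists n => //; exists U.
by rewrite lee_fin ler_pdivlMr.
Qed.

Lemma covering_number_ge (r : R) : 0 < r ->
  ((l / r)%:E <= covering_number dist r F)%E.
Proof.
move=> r0; apply: le_ereal_inf_tmp => _ [n [U [FU Ud]] <-].
have := Fl (pad_cover FU) (fun i => pad_diam i (ltW r0) Ud).
move=> /le_trans/(_ (pad_sum diam_set0 diam_ge0 Ud)).
by rewrite !lee_fin ler_pdivrMr.
Qed.

(** The limit that squeezes the box dimension: constant factors disappear. *)
Lemma ln_ratio_cvg1 (c : R) : 0 < c ->
  (lne (c / r)%:E * ((- ln r)^-1)%:E)%E @[r --> (0 : R)^'+] --> 1%E.
Proof.
move=> c0.
have Vln : (- ln r)^-1 @[r --> (0 : R)^'+] --> (0 : R).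
  apply/gtr0_cvgV0; last by apply/cvgNrNy; rewrite opprK; exact: lnNy.
  near=> r; rewrite oppr_gt0 ln_lt0//; apply/andP; split; near: r.
    exact: nbhs_right_gt.
  exact: nbhs_right_lt.
have : ln c * (- ln r)^-1 + 1 @[r --> (0 : R)^'+] --> ln c * 0 + 1.
  apply: cvgD; last exact: cvg_cst.
  exact: (cvgM (cvg_cst _) Vln).
rewrite mulr0 add0r => cvg1.
have : (ln c * (- ln r)^-1 + 1)%:E @[r --> (0 : R)^'+] --> 1%E.
  by apply: cvg_EFin => //; near=> r.
apply: cvg_trans; apply: near_eq_cvg.
near=> r.
have r0 : 0 < r by near: r; exact: nbhs_right_gt.
have r1 : r < 1 by near: r; exact: nbhs_right_lt.
have lr : ln r < 0 by rewrite ln_lt0// r0.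
rewrite lne_EFin ?divr_gt0// -EFinM; congr EFin.
by rewrite ln_div ?posrE// mulrDl divff// oppr_eq0 lt_eqF.
Unshelve. all: by end_near. Qed.

Lemma has_box_dim_eq1 : has_box_dim dist F 1%E.
Proof.
have C0 := linear_covers_gt0.
apply: squeeze_cvge (ln_ratio_cvg1 l0) (ln_ratio_cvg1 C0).
near=> r.
have r0 : 0 < r by near: r; exact: nbhs_right_gt.
have r1 : r < 1 by near: r; exact: nbhs_right_lt.
have lr : ln r < 0 by rewrite ln_lt0// r0.
have inv0 : (0 <= ((- ln r)^-1)%:E)%E by rewrite lee_fin invr_ge0 oppr_ge0 ltW.
have lb := covering_number_ge r0.
have ub : (covering_number dist r F <= (C / r)%:E)%E.
  by apply: covering_number_le; rewrite r0 ltW.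
have cov0 : (0 <= covering_number dist r F)%E.
  by apply: le_trans lb; rewrite lee_fin divr_ge0 ?ltW.
by apply/andP; split; apply: lee_wpmul2r => //; rewrite lee_lne//
  in_itv/= ?leey ?andbT// lee_fin divr_ge0 ?ltW.
Unshelve. all: by end_near. Qed.

End DimensionOne.

(** * Graphs of functions of bounded variation *)

Section Graphs.
Context {R : realType}.

Lemma affine_bound_bounded_variation (a b : R) (f : R -> R) (e L : R) :
  affine_variation_bound a b f e L -> bounded_variation a b f.
Proof.
move=> fL; exists (e + L * (b - a)) => _ [p abp <-].
pose v := nth b (a :: p).
have [abpath _] := abp.
have vlt i : (i < size p)%N -> v i < v i.+1.
  by move=> ip; rewrite /v /=; have /pathP := abpath; apply.
have vle i k : (i <= k)%N -> (k <= size p)%N -> v i <= v k.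
  elim: k => [|k IH]; first by rewrite leqn0 => /eqP ->.
  rewrite leq_eqVlt => /predU1P[-> //|ik] kp.
  by rewrite (le_trans (IH _ (ltnW kp)))// ltW// vlt.
have fam : nonoverlapping a b (fun i : 'I_(size p) => v i) (fun i => v i.+1).
  split=> [i|i k z /andP[z1 z2] /andP[z3 z4]].
    split; last 2 first.
    - exact/ltW/vlt.
    - by apply: itv_partition_nth_le => //; rewrite ltnS.
    - by apply: itv_partition_nth_ge => //; rewrite ltnS ltnW.
  apply/val_inj/eqP; rewrite eqn_leq; apply/andP; split; rewrite leqNgt;
    apply/negP => ik.
    by have := vle _ _ ik (ltnW (ltn_ord i)); rewrite leNgt (lt_trans z1 z4).
  by have := vle _ _ ik (ltnW (ltn_ord k)); rewrite leNgt (lt_trans z3 z2).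
have := fL _ _ _ fam; rewrite /variation big_mkord => /le_trans; apply.
rewrite -(big_mkord xpredT (fun i => v i.+1 - v i)) telescope_sumr//.
by rewrite /v (itv_partition_nth_size b abp).
Qed.

(** The function phi is the abscissa plus the variations of the coordinates of
    h on [a, t]; it dominates the distances on the graph. *)
Lemma graph_dist_le_monotone (M : nat) (a b : R) (h : R -> 'rV[R]_M) :
  (forall j, bounded_variation a b (fun t => h t 0 j)) ->
  exists phi : R -> R, forall s t, a <= s -> s <= t -> t <= b ->
    eucl_dist (s, h s) (t, h t) <= phi t - phi s.
Proof.
move=> hbv; pose hc j t := h t 0 j.
exists (fun t => t + \sum_(j < M) fine (total_variation a t (hc j))).
move=> s t as_ st tb; apply: le_trans (eucl_dist_le_sum _ _) _ => /=.
rewrite distrC ger0_norm ?subr_ge0// opprD addrACA lerD2l -sumrB.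
apply: ler_sum => j _; rewrite distrC -lee_fin.
have at_ := le_trans as_ st.
have fin_st : total_variation s t (hc j) \is a fin_num.
  apply/bounded_variationP => //; apply: bounded_variationr as_ st _.
  exact: bounded_variationl at_ tb (hbv j).
have fin_as : total_variation a s (hc j) \is a fin_num.
  apply/bounded_variationP => //.
  exact: bounded_variationl as_ (le_trans st tb) (hbv j).
rewrite (total_variationD _ as_ st) fineD// addrAC subrr add0r fineK//.
exact: total_variation_ge.
Qed.

(** The level sets i r <= phi t - phi a < (i + 1) r of the function phi of the
    previous lemma cut the graph into pieces of diameter at most r. *)
Lemma graph_linear_covers (M : nat) (a b : R) (h : R -> 'rV[R]_M) :
  (forall j, bounded_variation a b (fun t => h t 0 j)) ->
  exists C, linear_covers (@eucl_dist R M) (graph_on `[a, b] h) C.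
Proof.
move=> /graph_dist_le_monotone[phi phiP].
have phi_le s t : a <= s -> s <= t -> t <= b -> phi s <= phi t.
  move=> as_ st tb; rewrite -subr_ge0.
  exact: le_trans (eucl_dist_ge0 _ _) (phiP _ _ as_ st tb).
pose Phi := Num.max 0 (phi b - phi a).
exists (Phi + 1) => r /andP[r0 r1].
have Phi0 : 0 <= Phi by rewrite le_max lexx.
pose n := (Num.truncn (Phi / r)).+1.
pose U (i : 'I_n) := [set (t, h t) | t in
  [set t : R | t \in `[a, b] /\ i%:R * r <= phi t - phi a < i.+1%:R * r]].
exists n, U; split.
- rewrite /n -natr1 mulrDl mul1r lerD// -ler_pdivlMr// truncn_le.
  by rewrite divr_ge0// ltW.
- move=> _ [t /= tab <-].
  have /andP[at_ tb] : a <= t <= b by move: tab; rewrite in_itv.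
  have p0 : 0 <= (phi t - phi a) / r by rewrite divr_ge0 ?subr_ge0 ?phi_le// ltW.
  have pn : (Num.truncn ((phi t - phi a) / r) < n)%N.
    rewrite /n ltnS le_truncn// ler_wpM2r ?invr_ge0 ?(ltW r0)// le_max.
    by rewrite lerD2r phi_le ?orbT.
  exists (Ordinal pn) => //; exists t => //=; split=> //.
  by rewrite -ler_pdivlMr// -ltr_pdivrMr// truncn_le p0 truncnS_gt.
- move=> i; apply: diam_le (ltW r0) _ => u v [s [sab /andP[s1 s2]] <-].
  move=> [t [tab /andP[t1 t2]] <-].
  have /andP[as_ sb] : a <= s <= b by move: sab; rewrite in_itv.
  have /andP[at_ tb] : a <= t <= b by move: tab; rewrite in_itv.
  have iS : i.+1%:R * r = i%:R * r + r by rewrite -natr1 mulrDl mul1r.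
  have [st|/ltW ts] := leP s t.
    by apply: le_trans (phiP _ _ as_ st tb) _; lra.
  have -> : eucl_dist (s, h s) (t, h t) = eucl_dist (t, h t) (s, h s).
    rewrite /eucl_dist /eucl_norm/= -sqrrN opprB; congr (Num.sqrt (_ + _ ^+ 2)).
    by congr Num.sqrt; apply: eq_bigr => j _; rewrite !mxE -sqrrN opprB.
  by apply: le_trans (phiP _ _ at_ ts sb) _; lra.
Qed.

(** The projection of a set to the first axis lies in an interval not longer
    than its diameter. *)
Lemma projection_in_small_set (M : nat) (A : set (R * 'rV[R]_M)) (r : R) :
  (diam (@eucl_dist R M) A <= r%:E)%E ->
  exists I : set R, [/\ measurable I, fst @` A `<=` I &
    (lebesgue_measure I <= diam (@eucl_dist R M) A)%E].
Proof.
move=> Ar; have [->|/set0P[w Aw]] := eqVneq A set0.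
  exists set0; rewrite measure0 image_set0 diam_ge0; split => //.
have [D DE] : exists D, diam (@eucl_dist R M) A = D%:E.
  exists (fine (diam (@eucl_dist R M) A)).
  by rewrite fineK// ge0_fin_numE ?diam_ge0// (le_lt_trans Ar)// ltry.
have AD u v : A u -> A v -> `|u.1 - v.1| <= D.
  move=> Au Av; apply: le_trans (eucl_dist_ge_fst u v) _.
  by rewrite -lee_fin -DE dist_le_diam.
pose P := fst @` A.
have P0 : P !=set0 by exists w.1, w.
have Pub : has_ubound P.
  exists (w.1 + D) => _ [u Au <-].
  by have := AD _ _ Au Aw; rewrite ler_distl => /andP[].
have Plb : has_lbound P.
  exists (w.1 - D) => _ [u Au <-].
  by have := AD _ _ Au Aw; rewrite ler_distl => /andP[].
exists `[inf P, sup P]%classic; split.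
- exact: measurable_itv.
- move=> p Pp; rewrite /= in_itv/= ge_inf//=.
  exact: ub_le_sup.
- rewrite lebesgue_measure_itv/= DE; case: ifP => _; last first.
    by rewrite -DE diam_ge0.
  rewrite -EFinB lee_fin lerBlDr; apply: ge_sup => // _ [u Au <-].
  rewrite addrC -lerBlDr; apply: lb_le_inf => // _ [v Av <-].
  by have := AD _ _ Au Av; rewrite ler_distl => /andP[]; lra.
Qed.

(** Covering the graph covers [a, b] by the projections, so that the
    countable subadditivity of the Lebesgue measure applies. *)
Lemma graph_length_at_least (M : nat) (a b : R) (h : R -> 'rV[R]_M) :
  a < b -> length_at_least (@eucl_dist R M) (graph_on `[a, b] h) (b - a).
Proof.
move=> ab U r hU Ur.
have /choice[I HI] := fun i => projection_in_small_set (Ur i).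
have -> : (b - a)%:E = lebesgue_measure (`[a, b]%classic : set R).
  by rewrite lebesgue_measure_itv/= lte_fin ab EFinB.
apply: (@le_trans _ _ (\sum_(0 <= i <oo) lebesgue_measure (I i))%E).
  apply: measure_sigma_subadditive => [i||t tab].
  - by have [] := HI i.
  - exact: measurable_itv.
  - have /hU[i _ Ui] : graph_on `[a, b] h (t, h t) by exists t.
    by exists i => //; have [_ + _] := HI i; apply; exists (t, h t).
by apply: lee_nneseries => i *; have [] := HI i.
Qed.

End Graphs.

(** * Fractal interpolation functions *)

Section FractalInterpolation.
Context {R : realType}.

Lemma min_abs_le N (c : nat -> R) k : (1 <= k < N)%N -> min_abs N c <= `|c k|.
Proof. by move=> kN; apply: ge_bigmin_seq; rewrite // mem_index_iota. Qed.

Lemma max_abs_ge N (c : nat -> R) k : (1 <= k < N)%N -> `|c k| <= max_abs N c.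
Proof.
move=> kN; apply: (le_bigmax_seq _ _ _ (fun k => `|c k|)) => //.
by rewrite mem_index_iota.
Qed.

Lemma within_continuous_coord_bounded (M : nat) (a b : R) (h : R -> 'rV[R]_M)
    (j : 'I_M) : {within `[a, b], continuous h} ->
  exists B, forall t, a <= t <= b -> `|h t 0 j| <= B.
Proof.
move=> hc; pose hj (t : R) : R := h t 0 j.
have hjc : {within `[a, b], continuous hj}.
  move=> t; apply: (@continuous_comp (subspace `[a, b]) _ _ h
    (fun v : 'rV[R]_M => v 0 j)); [exact: hc|exact: coord_continuous].
have [B [_ HB]] := compact_bounded (continuous_compact hjc (@segment_compact _ a b)).
exists (B + 1) => t tab; apply: HB; first by rewrite ltrDl.
by exists t => //; rewrite /= in_itv.
Qed.

(** The functional equation of the interpolation function, from the invariance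
    of its graph. *)
Lemma fif_equation (M N : nat) (x : nat -> R) (a d alpha : nat -> R)
    (q : nat -> R -> 'rV[R]_M) (h : R -> 'rV[R]_M) :
  is_fif N x a d alpha q h -> forall k, (1 <= k < N)%N ->
  forall t, x 1%N <= t <= x N -> h (a k * t + d k) = alpha k *: h t + q k t.
Proof.
move=> [_ [_ _ _ graphE]] k kN t tJ.
have : graph_on `[x 1%N, x N] h (fif_map a d alpha q k (t, h t)).
  rewrite graphE; exists k => //; exists (t, h t) => //.
  by exists t => //; rewrite /= in_itv.
by move=> [s _ [-> <-]].
Qed.

End FractalInterpolation.

Theorem theorem3p20 (R : realType) (M N : nat) (x : nat -> R)
    (y : nat -> 'rV[R]_M) (a d alpha : nat -> R) (q : nat -> R -> 'rV[R]_M)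
    (h : R -> 'rV[R]_M) :
  fif_data N x y a d alpha q ->
  is_fif N x a d alpha q h ->
  (forall k, (1 <= k < N)%N -> abs_continuous (x 1%N) (x N) (q k)) ->
  max_abs N alpha < min_abs N a / (N%:R - 1) ->
  abs_continuous (x 1%N) (x N) h /\
  hausdorff_dim (@eucl_dist R M) (graph_on `[x 1%N, x N] h) = 1%E /\
  has_box_dim (@eucl_dist R M) (graph_on `[x 1%N, x N] h) 1%E.
Proof.
move=> data fif qac small; have feq := fif_equation fif.
have [hcont _] := fif.
have [_ N3 xlt Pl Pr acontr _ _ _ _] := data.
have x1k m : (0 < m <= N)%N -> x 1%N <= x m.
  elim: m => // -[//|m] IH /andP[_ mN].
  by rewrite (le_trans (IH (ltnW mN)))// ltW// xlt.
have x1N : x 1%N < x N.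
  have -> : N = N.-1.+1 by rewrite prednK// (ltn_trans _ N3).
  by apply: (le_lt_trans (x1k N.-1 _)); [|apply: xlt]; lia.
have a0 k : (1 <= k < N)%N -> 0 < a k.
  move=> kN; have : 0 < a k * (x N - x 1%N).
    have -> : a k * (x N - x 1%N) = x k.+1 - x k.
      by rewrite -(Pl k kN) -(Pr k kN); ring.
    by rewrite subr_gt0 xlt.
  by rewrite pmulr_lgt0// subr_gt0.
have N1 : 2 <= N%:R - 1 :> R.
  by rewrite lerBrDr natr1 ler_nat.
have small' : (N%:R - 1) * max_abs N alpha < min_abs N a.
  by move: small; rewrite ltr_pdivlMr 1?mulrC//; lra.
(* Both contraction conditions follow from (N - 1) alpha_max < a_min, using
   N - 1 >= 2 for 2 |alpha_k| <= a_k and a_1 < 1 for the sum of the |alpha_k|. *)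
have mx_k k : (1 <= k < N)%N -> (N%:R - 1) * `|alpha k| < a k.
  move=> kN; apply: (@le_lt_trans _ _ ((N%:R - 1) * max_abs N alpha)).
    by rewrite ler_wpM2l ?max_abs_ge//; lra.
  apply: lt_le_trans small' _; rewrite -[leRHS]ger0_norm ?min_abs_le//.
  by rewrite ltW// a0.
have al2 k : (1 <= k < N)%N -> 2 * `|alpha k| <= a k.
  move=> kN; apply: le_trans (ltW (mx_k k kN)).
  by rewrite ler_wpM2r.
have als : \sum_(1 <= k < N) `|alpha k| < 1.
  apply: (@le_lt_trans _ _ (\sum_(1 <= k < N) max_abs N alpha)).
    by rewrite big_nat [leRHS]big_nat; apply: ler_sum => k; exact: max_abs_ge.
  have N13 : (1 <= 1 < N)%N by rewrite /= (ltnW N3).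
  rewrite sumr_const_nat -[ltLHS]mulr_natl natrB ?(ltnW (ltnW N3))//.
  by apply: lt_trans small' _; apply: le_lt_trans (acontr _ N13); exact: min_abs_le.
have hL j (e : R) : 0 < e -> exists2 L : R, 0 <= L &
    affine_variation_bound (x 1%N) (x N) (fun t => h t 0 j) e L.
  have [B hB] := within_continuous_coord_bounded j hcont.
  apply: (self_affine_variation_bound (a := a) (d := d) (alpha := alpha)
    (g := fun k t => q k t 0 j) (B := B)) => //.
  - exact: ltn_trans N3.
  - exact: ltW.
  - by move=> k kN t tJ; rewrite feq// !mxE.
  - by move=> k kN e' e'0; apply: abs_continuous_affine_bound => //; exact: qac.
have [C hC] : exists C,
    linear_covers (@eucl_dist R M) (graph_on `[x 1%N, x N] h) C.
  apply: graph_linear_covers => j; have [L _] := hL j 1 ltr01.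
  exact: affine_bound_bounded_variation.
have hl := graph_length_at_least (h := h) x1N.
have l0 : 0 < x N - x 1%N by rewrite subr_gt0.
split; first exact: affine_bound_abs_continuous.
by split; [exact: hausdorff_dim_eq1 l0 hC hl|exact: has_box_dim_eq1 l0 hC hl].
Qed.
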